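(* Assume that each $f_i:\mathbb{R}^d\to\mathbb{R}$ ($i=1,\dots,N$) is $L$-smooth and that $\sigma_*^2:=\sup_{x\in\mathbb{R}^d}\|\Sigma_{\mathrm{MB}}(x)\|_S<\infty$. Let $\{x_k\}_{k\ge0}$ be the iterates of mini-batch SGD, $x_{k+1}=x_k-\eta_k\,\mathcal{G}_{\mathrm{MB}}(x_k,k)$, started at $x_0\in\mathbb{R}^d$. For $k\ge0$ let $\tilde k\in\{0,\dots,k\}$ be a random index (drawn independently of the iterates) equal to $j$ with probability $\psi_j/\varphi_{k+1}$ for $j\in\{0,\dots,k\}$. If $h\le\frac1L$, then $$\mathbb{E}\left[\|\nabla f(x_{\tilde k})\|^2\right]\le\frac{2\,(f(x_0)-f(x^\star))}{h\varphi_{k+1}}+\frac{h\,d\,L\,\sigma_*^2}{h\varphi_{k+1}}\sum_{i=0}^k\frac{\psi_i^2}{b_i}\,h .$$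
   Context: $f_1,\dots,f_N:\mathbb{R}^d\to\mathbb{R}$ are continuously differentiable, $f:=\frac1N\sum_{i=1}^Nf_i$, and $x^\star\in\mathbb{R}^d$ is a global minimizer of $f$. A differentiable function $g$ is $L$-smooth if $\|\nabla g(x)-\nabla g(y)\|\le L\|x-y\|$ for all $x,y$. $\|\cdot\|$ is the Euclidean norm and $\|\cdot\|_S$ the spectral norm. The learning rates $(\eta_k)_{k\ge0}$ form a deterministic non-increasing sequence of positive numbers; $h:=\eta_0$, $\psi_k:=\eta_k/h$, and $\varphi_{k+1}:=\sum_{i=0}^k\psi_i$. The mini-batch gradient estimator is $\mathcal{G}_{\mathrm{MB}}(x_k,k):=\frac1{b_k}\sum_{i_k\in\Omega_k}\nabla f_{i_k}(x_k)$, where the $b_k\ge1$ indices in the mini-batch $\Omega_k$ are sampled, at each iteration, independently, uniformly and with replacement from $\{1,\dots,N\}$ (independently of the past). The one-sample covariance is $$\Sigma_{\mathrm{MB}}(x):=\frac1N\sum_{i=1}^N(\nabla f(x)-\nabla f_i(x))(\nabla f(x)-\nabla f_i(x))^T .$$ *)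

(* Defs.v *)
From HB Require Import structures.
From mathcomp Require Import all_boot all_order all_algebra.
From mathcomp Require Import all_classical all_reals all_analysis.

Set Implicit Arguments.
Unset Strict Implicit.
Unset Printing Implicit Defensive.

Import Order.TTheory GRing.Theory Num.Theory.
Import numFieldNormedType.Exports.

Local Open Scope classical_set_scope.
Local Open Scope ring_scope.

(* The library's norm on matrices is the sup norm; it induces the same
   topology, hence the same differentiability, as the Euclidean norm. *)
Definition enorm (R : realType) (n : nat) (v : 'cV[R]_n) : R :=
  Num.sqrt (\sum_(i < n) v i 0 ^+ 2).

Definition specnorm (R : realType) (n : nat) (A : 'M[R]_n) : R :=
  sup [set enorm (A *m v) | v in [set v : 'cV[R]_n | enorm v <= 1]].

(* The column of partial derivatives along the standard basis. *)
Definition grad (R : realType) (d : nat) (g : 'cV[R]_d -> R) (x : 'cV[R]_d) :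
    'cV[R]_d :=
  \col_(j < d) 'D_(delta_mx j 0) g x.

Definition C1 (R : realType) (d : nat) (g : 'cV[R]_d -> R) : Prop :=
  (forall x, differentiable g x) /\ continuous (grad g).

Definition Lsmooth (R : realType) (d : nat) (L : R) (g : 'cV[R]_d -> R) : Prop :=
  (forall x, differentiable g x) /\
  (forall x y, enorm (grad g x - grad g y) <= L * enorm (x - y)).

Definition favg (R : realType) (d N : nat) (f : 'I_N -> 'cV[R]_d -> R)
    (x : 'cV[R]_d) : R :=
  N%:R^-1 * \sum_(i < N) f i x.

Definition SigmaMB (R : realType) (d N : nat) (f : 'I_N -> 'cV[R]_d -> R)
    (x : 'cV[R]_d) : 'M[R]_d :=
  N%:R^-1 *: \sum_(i < N) ((grad (favg f) x - grad (f i) x) *m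
                           (grad (favg f) x - grad (f i) x)^T).

(* Extended-real valued, so that finiteness is a genuine hypothesis. *)
Definition sigmastar2 (R : realType) (d N : nat)
    (f : 'I_N -> 'cV[R]_d -> R) : \bar R :=
  ereal_sup (range (fun x => (specnorm (SigmaMB f x))%:E)).

Definition psi (R : realType) (eta : nat -> R) (k : nat) : R := eta k / eta 0%N.

Definition phi (R : realType) (eta : nat -> R) (n : nat) : R :=
  \sum_(i < n) psi eta i.

(* [om k j] is the [j]-th index drawn at iteration [k]. *)
Definition GMB (R : realType) (d N : nat) (f : 'I_N -> 'cV[R]_d -> R)
    (b : nat -> nat) (T : Type) (om : forall k : nat, 'I_(b k) -> T -> 'I_N)
    (x : 'cV[R]_d) (k : nat) (w : T) : 'cV[R]_d :=
  (b k)%:R^-1 *: \sum_(j < b k) grad (f (om k j w)) x.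

Fixpoint sgd (R : realType) (d N : nat) (f : 'I_N -> 'cV[R]_d -> R)
    (b : nat -> nat) (T : Type) (om : forall k : nat, 'I_(b k) -> T -> 'I_N)
    (eta : nat -> R) (x0 : 'cV[R]_d) (k : nat) (w : T) : 'cV[R]_d :=
  if k is k'.+1 then
    sgd f om eta x0 k' w - eta k' *: GMB f om (sgd f om eta x0 k' w) k' w
  else x0.

(* Values in a finite type carry the discrete sigma-algebra. *)
Definition finite_rv (dT : measure_display) (T : measurableType dT)
    (E : finType) (X : T -> E) : Prop :=
  forall A : set E, measurable (X @^-1` A).

Definition sigalg_rv (T : Type) (E : finType) (X : T -> E) : set (set T) :=
  preimage_set_system setT X setT.

Definition borel (U : topologicalType) : set (set U) := <<s @open U >>.

Definition sigalg_process (T : Type) (U : topologicalType) (X : nat -> T -> U) :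
    set (set T) :=
  <<s \bigcup_(k in [set: nat]) preimage_set_system setT (X k) (@borel U) >>.

Definition mutually_independent (dT : measure_display) (T : measurableType dT)
    (R : realType) (P : probability T R) (I : choiceType)
    (F : I -> set (set T)) : Prop :=
  forall (J : seq I) (A : I -> set T), uniq J -> (forall i, i \in J -> F i (A i)) ->
    P (\bigcap_(i in [set` J]) A i) = (\prod_(i <- J) P (A i))%E.

Definition independent2 (dT : measure_display) (T : measurableType dT)
    (R : realType) (P : probability T R) (F G : set (set T)) : Prop :=
  forall A B : set T, F A -> G B -> P (A `&` B) = (P A * P B)%E.

(* Main.v *)
Require Import Defs.
From HB Require Import structures.
From mathcomp Require Import all_boot all_order all_algebra.
From mathcomp Require Import all_classical all_reals all_analysis.
From mathcomp Require Import measurable_realfun.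
From mathcomp Require Import ring lra.

Set Implicit Arguments.
Unset Strict Implicit.
Unset Printing Implicit Defensive.

Import Order.TTheory GRing.Theory Num.Theory.
Import numFieldNormedType.Exports.

Local Open Scope classical_set_scope.
Local Open Scope ring_scope.

(** The proof is a one-step descent estimate, averaged over the randomness and
    telescoped.

    One step.  An [L]-smooth [g] lies below the quadratic
    [g x + <grad g x, y - x> + L / 2 |y - x|^2] (lemma [descent]).  At
    [y = x - e G], with [G] the mini-batch gradient, averaging over the batch
    leaves only the first two moments of [G]: its mean is the full gradient
    ([batch_grad_mean]), and its variance is the one-sample variance divided by
    the batch size ([batch_grad_var]).  The one-sample variance is the trace of
    the covariance matrix, hence at most [d] times its spectral norm
    ([gradvar_le]).  When [e L <= 1] the coefficient [e (1 - e L / 2)] of the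
    squared gradient is at least [e / 2], which gives [sgd_step].

    Summation.  Summing [sgd_step] along the iterations telescopes the values
    of the objective, which stay above the minimum ([sgd_sum]).  The resulting
    bound on the sum of the [eta i * E |grad f (x_i)|^2] is the theorem after
    division by the sum of the [eta i], since the weights of the random index
    are proportional to [eta].

    Probability.  The iterate [x_k] depends on finitely many draws, so it is a
    function of a random variable with values in the finite type [hist] of
    histories.  Mutual independence and uniformity of the draws make the
    history uniform ([hist_law]), so every expectation of a function
    of [x_k] is an arithmetic mean over histories ([expectation_sgd]), and the
    analysis above is carried out with such means only.  Independence of the
    random index is used through [expectation_random_index]. *)

(** * Means over finite types *)

Definition mean (R : realType) (E : finType) (F : E -> R) : R :=
  #|E|%:R^-1 * \sum_e F e.

Lemma eq_mean (R : realType) (E : finType) (F G : E -> R) :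
  F =1 G -> mean F = mean G.
Proof. by move=> FG; congr (_ * _); apply: eq_bigr => e _. Qed.

Lemma meanD (R : realType) (E : finType) (F G : E -> R) :
  mean (fun e => F e + G e) = mean F + mean G.
Proof. by rewrite /mean big_split mulrDr. Qed.

Lemma meanZ (R : realType) (E : finType) (c : R) (F : E -> R) :
  mean (fun e => c * F e) = c * mean F.
Proof. by rewrite /mean -mulr_sumr mulrCA. Qed.

Lemma mean_sum (R : realType) (E I : finType) (F : I -> E -> R) :
  mean (fun e => \sum_i F i e) = \sum_i mean (F i).
Proof. by rewrite /mean exchange_big mulr_sumr. Qed.

Lemma mean_cst (R : realType) (E : finType) (c : R) :
  (0 < #|E|)%N -> mean (fun _ : E => c) = c.
Proof.
move=> E0; rewrite /mean sumr_const -[c *+ _]mulr_natl mulKf //.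
by rewrite pnatr_eq0 -lt0n.
Qed.

Lemma ler_mean (R : realType) (E : finType) (F G : E -> R) :
  (forall e, F e <= G e) -> mean F <= mean G.
Proof.
by move=> FG; rewrite ler_wpM2l ?invr_ge0 ?ler0n//; apply: ler_sum => e _.
Qed.

Lemma mean_pair (R : realType) (E1 E2 : finType) (F : E1 * E2 -> R) :
  mean F = mean (fun e1 => mean (fun e2 => F (e1, e2))).
Proof.
rewrite /mean card_prod natrM invfM -mulrA -mulr_sumr; congr (_ * (_ * _)).
by rewrite pair_bigA; apply: eq_bigr => -[].
Qed.

(** The uniform law on functions [I -> E] is a product law: distributivity of
    products over sums. *)
Lemma mean_ffun_prod (R : realType) (I E : finType) (F : I -> E -> R) :
  mean (fun s : {ffun I -> E} => \prod_i F i (s i)) = \prod_i mean (F i).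
Proof.
rewrite /mean big_split/= -bigA_distr_bigA prodr_const card_ffun.
by rewrite natrX exprVn.
Qed.

Lemma mean_ffun1 (R : realType) (I E : finType) (F : E -> R) (i : I) :
  (0 < #|E|)%N -> mean (fun s : {ffun I -> E} => F (s i)) = mean F.
Proof.
move=> E0.
(* [F (s i)] as a product over all indices, with trivial factors elsewhere. *)
pose H j e := if j == i then F e else 1.
transitivity (mean (fun s : {ffun I -> E} => \prod_j H j (s j))).
  apply: eq_mean => s; rewrite (bigD1 i)//= /H eqxx big1 ?mulr1// => j.
  by move=> /negbTE ->.
rewrite mean_ffun_prod (bigD1 i)//= /H eqxx big1 ?mulr1// => j /negbTE ->.
exact: mean_cst.
Qed.

Lemma mean_ffun2 (R : realType) (I E : finType) (F G : E -> R) (i j : I) :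
  (0 < #|E|)%N -> i != j ->
  mean (fun s : {ffun I -> E} => F (s i) * G (s j)) = mean F * mean G.
Proof.
move=> E0 ij.
pose H l e := if l == i then F e else if l == j then G e else 1.
have ji : j != i by rewrite eq_sym.
transitivity (mean (fun s : {ffun I -> E} => \prod_l H l (s l))).
  apply: eq_mean => s; rewrite (bigD1 i)//= (bigD1 j)//=.
  rewrite {1 2}/H !eqxx (negbTE ji) big1 ?mulr1// => l /andP[li lj].
  by rewrite /H (negbTE li) (negbTE lj).
rewrite mean_ffun_prod (bigD1 i)//= (bigD1 j)//=.
rewrite {1 2}/H !eqxx (negbTE ji) big1 ?mulr1// => l /andP[li lj].
by rewrite /H (negbTE li) (negbTE lj) mean_cst.
Qed.

(** Variance of a sum of independent centred variables: the off-diagonal terms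
    of the expanded square vanish. *)
Lemma mean_sqr_sum (R : realType) (I E : finType) (u : E -> R) :
  (0 < #|E|)%N -> mean u = 0 ->
  mean (fun s : {ffun I -> E} => (\sum_i u (s i)) ^+ 2)
    = #|I|%:R * mean (fun e => u e ^+ 2).
Proof.
move=> E0 u0.
transitivity (\sum_(i : I) \sum_(j : I)
    mean (fun s : {ffun I -> E} => u (s i) * u (s j))).
  under eq_bigr do rewrite -mean_sum.
  rewrite -mean_sum; apply: eq_mean => s.
  by rewrite expr2 mulr_suml; apply: eq_bigr => i _; rewrite mulr_sumr.
rewrite mulr_natl -sumr_const; apply: eq_bigr => i _.
rewrite (bigD1 i)//= big1 ?addr0 => [|j ji].
  by rewrite -(mean_ffun1 (fun e => u e ^+ 2) i E0); apply: eq_mean.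
by rewrite mean_ffun2 1?eq_sym// u0 mul0r.
Qed.

(** * Smooth functions and the quadratic upper bound *)

Definition dotp (R : realType) (d : nat) (u v : 'cV[R]_d) : R :=
  \sum_(j < d) u j 0 * v j 0.

Lemma enorm_ge0 (R : realType) (d : nat) (v : 'cV[R]_d) : 0 <= enorm v.
Proof. exact: sqrtr_ge0. Qed.

Lemma sqr_enorm (R : realType) (d : nat) (v : 'cV[R]_d) :
  enorm v ^+ 2 = \sum_(j < d) v j 0 ^+ 2.
Proof. by rewrite sqr_sqrtr// sumr_ge0// => j _; exact: sqr_ge0. Qed.

Lemma sqr_enormZ (R : realType) (d : nat) (c : R) (v : 'cV[R]_d) :
  enorm (c *: v) ^+ 2 = c ^+ 2 * enorm v ^+ 2.
Proof.
by rewrite !sqr_enorm mulr_sumr; apply: eq_bigr => j _; rewrite mxE exprMn.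
Qed.

(** Cauchy-Schwarz for [u] of norm at most [c |v|], read off the expansion of
    [0 <= |u - c v|^2]. *)
Lemma dotp_le (R : realType) (d : nat) (c : R) (u v : 'cV[R]_d) :
  0 < c -> enorm u ^+ 2 <= c ^+ 2 * enorm v ^+ 2 ->
  dotp u v <= c * enorm v ^+ 2.
Proof.
move=> c0; rewrite !sqr_enorm => uv.
have : 0 <= \sum_(j < d) (u j 0 - c * v j 0) ^+ 2.
  by apply: sumr_ge0 => j _; exact: sqr_ge0.
have -> : \sum_(j < d) (u j 0 - c * v j 0) ^+ 2 =
    \sum_(j < d) u j 0 ^+ 2 - 2 * c * dotp u v
    + c ^+ 2 * \sum_(j < d) v j 0 ^+ 2.
  rewrite /dotp !mulr_sumr -sumrB -big_split/=.
  by apply: eq_bigr => j _; ring.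
move=> h; rewrite -(ler_pM2l c0); nra.
Qed.

Lemma derive_dotp (R : realType) (d : nat) (g : 'cV[R]_d -> R)
    (x v : 'cV[R]_d) :
  differentiable g x -> 'D_v g x = dotp (grad g x) v.
Proof.
move=> gx; rewrite deriveE//.
have {1}-> : v = \sum_(j < d) v j 0 *: delta_mx j 0.
  rewrite {1}(matrix_sum_delta v); apply: eq_bigr => j _.
  by rewrite big_ord1.
rewrite linear_sum; apply: eq_bigr => j _.
by rewrite linearZ/= mxE deriveE// mulrC.
Qed.

(** The two difference quotients, of [g] along [v] and of [g] restricted to the
    line, are the same function. *)
Lemma is_derive_line (R : realType) (d : nat) (g : 'cV[R]_d -> R)
    (x v : 'cV[R]_d) (t : R) :
  differentiable g (x + t *: v) ->
  is_derive t (1 : R) (fun s : R => g (x + s *: v))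
    (dotp (grad g (x + t *: v)) v).
Proof.
move=> gx.
have quotient :
    (fun h : R => h^-1 *: (((fun s : R => g (x + s *: v)) \o shift t)
                             (h *: (1 : R)) - g (x + t *: v))) =
    (fun h : R => h^-1 *: ((g \o shift (x + t *: v)) (h *: v)
                           - g (x + t *: v))).
  apply/funext => h /=; congr (_ *: (g _ - _)).
  by rewrite [h *: _]mulr1 scalerDl addrCA.
apply: DeriveDef; first by rewrite /derivable quotient; exact: diff_derivable.
by rewrite -derive_dotp// /derive quotient.
Qed.

(** Restricted to the segment from [x] to [y] and with its quadratic upper model
    subtracted, [g] becomes the function [F] below.  Its derivative at [t] is at
    most [0] because the gradient varies by at most [L t |y - x|]. *)
Lemma descent (R : realType) (d : nat) (L : R) (g : 'cV[R]_d -> R) :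
  0 < L -> Lsmooth L g -> forall x y,
  g y <= g x + dotp (grad g x) (y - x) + L / 2 * enorm (y - x) ^+ 2.
Proof.
move=> L0 [gdiff glip] x y; set v := y - x.
pose a := dotp (grad g x) v; pose c := L / 2 * enorm v ^+ 2.
pose F (t : R) : R := g (x + t *: v) - (a * t + c * t ^+ 2).
have dF (t : R) : is_derive t (1 : R) F
    (dotp (grad g (x + t *: v)) v - (a + c * 2 * t)).
  apply: is_deriveB; first exact: is_derive_line.
  apply: is_derive_eq.
  by rewrite /GRing.scale/=; ring.
have F10 : F 1 <= F 0.
  apply: (@ler0_derive1_le_cc _ F 0 1); rewrite ?in_itv/= ?ler01 ?lexx//.
  - move=> t; rewrite in_itv/= => /andP[t0 _].
    rewrite derive1E (@derive_val _ _ _ _ _ _ _ (dF t)).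
    have gt : dotp (grad g (x + t *: v) - grad g x) v <= L * t * enorm v ^+ 2.
      apply: dotp_le; first by rewrite mulr_gt0.
      have := glip (x + t *: v) x; rewrite addrAC subrr add0r => h.
      have := ler_pM (enorm_ge0 _) (enorm_ge0 _) h h.
      by rewrite -!expr2 exprMn sqr_enormZ exprMn mulrA.
    have : dotp (grad g (x + t *: v) - grad g x) v =
        dotp (grad g (x + t *: v)) v - a.
      by rewrite /a /dotp -sumrB; apply: eq_bigr => j _; rewrite !mxE mulrBl.
    move: gt; rewrite /c => gt e; move: gt; rewrite e => gt; lra.
  - apply: derivable_within_continuous => t _.
    exact: (@ex_derive _ _ _ _ _ _ _ (dF t)).
move: F10; rewrite /F scale1r scale0r addr0 /v subrKC -/v.
rewrite mulr0 expr0n/= mulr0 addr0 subr0 mulr1 expr1n mulr1 -/a -/c; lra.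
Qed.

(** * The averaged objective and the gradient variance *)

Lemma grad_favg (R : realType) (d N : nat) (f : 'I_N -> 'cV[R]_d -> R)
    (x : 'cV[R]_d) (j : 'I_d) :
  (forall i, differentiable (f i) x) ->
  grad (favg f) x j 0 = mean (fun i => grad (f i) x j 0).
Proof.
move=> fx; rewrite /mean card_ord mxE.
have -> : favg f = (N%:R^-1 : R) \*: (\sum_(i < N) f i : 'cV[R]_d -> R).
  by apply/funext => y; rewrite /favg /= fct_sumE.
have fD i : derivable (f i) x (delta_mx j 0) by exact: diff_derivable.
rewrite deriveZ; last exact: derivable_sum.
rewrite derive_sum//; congr (_ * _).
by apply: eq_bigr => i _; rewrite mxE.
Qed.

(** The average of the quadratic bounds of the [f i], whose linear terms add up
    to the gradient of the average. *)
Lemma descent_favg (R : realType) (d N : nat) (L : R)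
    (f : 'I_N -> 'cV[R]_d -> R) :
  (0 < N)%N -> 0 < L -> (forall i, Lsmooth L (f i)) -> forall x y,
  favg f y <= favg f x + dotp (grad (favg f) x) (y - x)
              + L / 2 * enorm (y - x) ^+ 2.
Proof.
move=> N0 L0 fL x y.
have favgE z : favg f z = mean (fun i => f i z) by rewrite /mean card_ord.
have {1}-> : dotp (grad (favg f) x) (y - x) =
    mean (fun i => dotp (grad (f i) x) (y - x)).
  rewrite mean_sum; apply: eq_bigr => j _.
  rewrite grad_favg => [|i]; last by have [] := fL i.
  by rewrite mulrC -meanZ; apply: eq_mean => i; rewrite mulrC.
rewrite !favgE -[X in _ <= _ + X](@mean_cst _ 'I_N) ?card_ord// -!meanD.
by apply: ler_mean => i; exact: descent.
Qed.

Lemma coord_le_enorm (R : realType) (d : nat) (v : 'cV[R]_d) (j : 'I_d) :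
  `|v j 0| <= enorm v.
Proof.
rewrite -(@ler_pXn2r _ 2)// ?nnegrE ?normr_ge0 ?enorm_ge0//.
rewrite sqr_enorm real_normK ?num_real// (bigD1 j)//= lerDl.
by apply: sumr_ge0 => i _; exact: sqr_ge0.
Qed.

Lemma enorm_le_sum (R : realType) (d : nat) (v : 'cV[R]_d) :
  enorm v <= \sum_(j < d) `|v j 0|.
Proof.
rewrite -(@ler_pXn2r _ 2)// ?nnegrE ?enorm_ge0 ?sumr_ge0//.
rewrite sqr_enorm expr2 mulr_suml; apply: ler_sum => j _.
rewrite -real_normK ?num_real// expr2 ler_wpM2l//.
by rewrite (bigD1 j)//= lerDl sumr_ge0.
Qed.

Lemma enorm_delta (R : realType) (d : nat) (j : 'I_d) :
  enorm (delta_mx j 0 : 'cV[R]_d) = 1.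
Proof.
rewrite /enorm (bigD1 j)//= big1 => [|i ij].
  by rewrite mxE !eqxx expr1n addr0 sqrtr1.
by rewrite mxE (negbTE ij) expr0n.
Qed.

(** The diagonal entry is a coordinate of the image of a unit vector.  Since
    [specnorm] is a supremum of reals, the set must also be shown bounded. *)
Lemma diag_le_specnorm (R : realType) (d : nat) (A : 'M[R]_d) (j : 'I_d) :
  A j j <= specnorm A.
Proof.
apply: (@le_trans _ _ (enorm (A *m delta_mx j 0 : 'cV[R]_d))).
  apply: le_trans (coord_le_enorm _ j).
  by rewrite -colE mxE ler_norm.
apply: ub_le_sup; last by exists (delta_mx j 0) => //=; rewrite enorm_delta.
exists (\sum_(i < d) \sum_(l < d) `|A i l|) => _ [v /= v1 <-].
apply: le_trans (enorm_le_sum _) _; apply: ler_sum => i _.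
rewrite mxE; apply: le_trans (ler_norm_sum _ _ _) _; apply: ler_sum => l _.
by rewrite normrM ler_piMr// (le_trans (coord_le_enorm _ _)).
Qed.

(** The trace of [SigmaMB f x], as a mean of squared norms. *)
Definition gradvar (R : realType) (d N : nat) (f : 'I_N -> 'cV[R]_d -> R)
    (x : 'cV[R]_d) : R :=
  mean (fun i => enorm (grad (f i) x - grad (favg f) x) ^+ 2).

Lemma gradvar_le (R : realType) (d N : nat) (f : 'I_N -> 'cV[R]_d -> R)
    (x : 'cV[R]_d) :
  (sigmastar2 f < +oo)%E -> gradvar f x <= d%:R * fine (sigmastar2 f).
Proof.
move=> fin.
have trE : gradvar f x = \sum_(j < d) SigmaMB f x j j.
  rewrite /gradvar; under eq_mean do rewrite sqr_enorm.
  rewrite mean_sum; apply: eq_bigr => j _.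
  rewrite /mean card_ord mxE summxE; congr (_ * _); apply: eq_bigr => i _.
  rewrite [in RHS]mxE big_ord1.
  by rewrite !mxE; ring.
have le_sigma j : SigmaMB f x j j <= fine (sigmastar2 f).
  apply: le_trans (diag_le_specnorm _ _) _.
  have le_sup : ((specnorm (SigmaMB f x))%:E <= sigmastar2 f)%E.
    by apply: ereal_sup_ubound; exists x.
  rewrite -lee_fin fineK// fin_numE -ltey fin andbT gt_eqF//.
  exact: lt_le_trans (ltNyr _) le_sup.
rewrite trE mulr_natl -[X in _ *+ X]card_ord -sumr_const.
exact: ler_sum.
Qed.

(** * One step of mini-batch SGD *)

Definition batch_grad (R : realType) (d N n : nat) (f : 'I_N -> 'cV[R]_d -> R)
    (s : {ffun 'I_n -> 'I_N}) (x : 'cV[R]_d) : 'cV[R]_d :=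
  n%:R^-1 *: \sum_(j < n) grad (f (s j)) x.

Lemma batch_grad_mean (R : realType) (d N n : nat) (f : 'I_N -> 'cV[R]_d -> R)
    (x : 'cV[R]_d) (c : 'I_d) :
  (0 < N)%N -> (0 < n)%N -> (forall i, differentiable (f i) x) ->
  mean (fun s : {ffun 'I_n -> 'I_N} => batch_grad f s x c 0)
    = grad (favg f) x c 0.
Proof.
move=> N0 n0 fx; rewrite grad_favg//.
under eq_mean do rewrite mxE summxE.
rewrite meanZ mean_sum.
under eq_bigr do rewrite (mean_ffun1 (fun i => grad (f i) x c 0)) ?card_ord//.
by rewrite sumr_const card_ord -[mean _ *+ n]mulr_natl mulKf ?pnatr_eq0 -?lt0n.
Qed.

(** Coordinatewise, the deviation of the batch gradient is [n^-1] times a sum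
    of [n] independent centred terms. *)
Lemma batch_grad_var (R : realType) (d N n : nat) (f : 'I_N -> 'cV[R]_d -> R)
    (x : 'cV[R]_d) :
  (0 < N)%N -> (0 < n)%N -> (forall i, differentiable (f i) x) ->
  mean (fun s : {ffun 'I_n -> 'I_N} =>
          enorm (batch_grad f s x - grad (favg f) x) ^+ 2)
    = n%:R^-1 * gradvar f x.
Proof.
move=> N0 n0 fx; have nn0 : n%:R != 0 :> R by rewrite pnatr_eq0 -lt0n.
under eq_mean do rewrite sqr_enorm.
rewrite mean_sum /gradvar; under [in RHS]eq_mean do rewrite sqr_enorm.
rewrite mean_sum mulr_sumr; apply: eq_bigr => c _.
pose u i : R := grad (f i) x c 0 + - grad (favg f) x c 0.
have u0 : mean u = 0.
  by rewrite meanD mean_cst ?card_ord// -grad_favg// subrr.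
transitivity (mean (fun s : {ffun 'I_n -> 'I_N} =>
    n%:R^-1 ^+ 2 * (\sum_(j < n) u (s j)) ^+ 2)).
  apply: eq_mean => s; rewrite -exprMn; congr (_ ^+ 2).
  rewrite /u big_split/= sumr_const card_ord -[- _ *+ n]mulr_natl mulrDr.
  rewrite mulKf//.
  by rewrite [LHS]mxE [X in _ + X]mxE [X in X + _]mxE summxE.
rewrite meanZ mean_sqr_sum ?card_ord// expr2 -mulrA mulKf//.
by congr (_ * _); apply: eq_mean => i; rewrite [in RHS]mxE [X in _ + X]mxE.
Qed.

(** With [D] the deviation of the batch gradient from [G = grad (favg f) x], the
    quadratic bound is affine in [<G, D>], which has mean zero, and in
    [|D|^2], whose mean is the variance. *)
Lemma sgd_step (R : realType) (d N n : nat) (L e : R)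
    (f : 'I_N -> 'cV[R]_d -> R) (x : 'cV[R]_d) :
  (0 < N)%N -> (0 < n)%N -> 0 < L -> (forall i, Lsmooth L (f i)) ->
  (sigmastar2 f < +oo)%E -> 0 < e -> e * L <= 1 ->
  mean (fun s : {ffun 'I_n -> 'I_N} => favg f (x - e *: batch_grad f s x))
    <= favg f x - e / 2 * enorm (grad (favg f) x) ^+ 2
       + L * e ^+ 2 / 2 * (d%:R * fine (sigmastar2 f) / n%:R).
Proof.
move=> N0 n0 L0 fL fin e0 eL.
have fx i : differentiable (f i) x by have [] := fL i.
pose G := grad (favg f) x.
pose D (s : {ffun 'I_n -> 'I_N}) := batch_grad f s x - G.
have D0 : mean (fun s => dotp G (D s)) = 0.
  rewrite mean_sum big1// => c _; rewrite meanZ.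
  have -> : mean (fun s => D s c 0) =
      mean (fun s : {ffun 'I_n -> 'I_N} => batch_grad f s x c 0 + - G c 0).
    by apply: eq_mean => s; rewrite !mxE.
  rewrite meanD mean_cst ?card_ffun ?card_ord ?expn_gt0 ?N0//.
  by rewrite batch_grad_mean// subrr mulr0.
have step s : favg f (x - e *: batch_grad f s x) <=
    (favg f x + (- e + L * e ^+ 2 / 2) * enorm G ^+ 2)
    + (- e + L * e ^+ 2) * dotp G (D s) + L * e ^+ 2 / 2 * enorm (D s) ^+ 2.
  apply: le_trans (descent_favg N0 L0 fL x _) _.
  have -> : x - e *: batch_grad f s x - x = - e *: batch_grad f s x.
    by rewrite addrAC subrr sub0r scaleNr.
  rewrite -/G sqr_enormZ sqrrN.
  have -> : dotp G (- e *: batch_grad f s x) =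
      - e * (enorm G ^+ 2 + dotp G (D s)).
    rewrite sqr_enorm /dotp -big_split/= mulr_sumr; apply: eq_bigr => c _.
    by rewrite !mxE; ring.
  have -> : enorm (batch_grad f s x) ^+ 2 =
      enorm G ^+ 2 + 2 * dotp G (D s) + enorm (D s) ^+ 2.
    rewrite !sqr_enorm /dotp mulr_sumr -!big_split/=; apply: eq_bigr => c _.
    by rewrite !mxE; ring.
  lra.
apply: le_trans (ler_mean step) _.
rewrite 2!meanD [mean (fun=> _)]mean_cst ?card_ffun ?card_ord ?expn_gt0 ?N0//.
rewrite !meanZ.
rewrite D0 batch_grad_var// mulr0 addr0.
apply: lerD.
  rewrite lerD2l -mulNr ler_wpM2r ?sqr_ge0//.
  by have := ler_wpM2l (ltW e0) eL; rewrite expr2; lra.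
apply: ler_wpM2l; first by rewrite divr_ge0// mulr_ge0 ?sqr_ge0// ltW.
by rewrite mulrC ler_wpM2r ?invr_ge0 ?ler0n// gradvar_le.
Qed.

(** * Histories and the telescoped bound *)

(** All the draws of the first [k] iterations.  The recursive product makes
    conditioning on the past a mere iterated mean ([mean_pair]). *)
Fixpoint hist (N : nat) (b : nat -> nat) (k : nat) : finType :=
  if k is k'.+1 then (hist N b k' * {ffun 'I_(b k') -> 'I_N})%type else unit.

Fixpoint hist_sgd (R : realType) (d N : nat) (f : 'I_N -> 'cV[R]_d -> R)
    (b : nat -> nat) (eta : nat -> R) (x0 : 'cV[R]_d) (k : nat) :
    hist N b k -> 'cV[R]_d :=
  if k is k'.+1 then fun h =>
    hist_sgd f eta x0 h.1 - eta k' *: batch_grad f h.2 (hist_sgd f eta x0 h.1)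
  else fun=> x0.

Fixpoint hist_of (N : nat) (b : nat -> nat) (a : forall k, 'I_(b k) -> 'I_N)
    (k : nat) : hist N b k :=
  if k is k'.+1 then (hist_of a k', [ffun j => a k' j]) else tt.

Lemma card_hist (N : nat) (b : nat -> nat) (k : nat) :
  #|hist N b k| = (\prod_(0 <= i < k) N ^ b i)%N.
Proof.
elim: k => [|k IHk]; first by rewrite big_geq// card_unit.
by rewrite big_nat_recr//= card_prod IHk card_ffun !card_ord.
Qed.

Lemma card_hist_gt0 (N : nat) (b : nat -> nat) (k : nat) :
  (0 < N)%N -> (0 < #|hist N b k|)%N.
Proof.
by move=> N0; rewrite card_hist prodn_gt0// => i; rewrite expn_gt0 N0.
Qed.

Lemma sgd_hist (R : realType) (d N : nat) (f : 'I_N -> 'cV[R]_d -> R)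
    (b : nat -> nat) (T : Type) (om : forall k, 'I_(b k) -> T -> 'I_N)
    (eta : nat -> R) (x0 : 'cV[R]_d) (k : nat) (w : T) :
  sgd f om eta x0 k w
    = hist_sgd f eta x0 (hist_of (fun i j => om i j w) k).
Proof.
elim: k => //= k <-; congr (_ - _ *: (_ *: _)).
by apply: eq_bigr => j _; rewrite ffunE.
Qed.

(** [sgd_step] holds for each history, hence on average over histories; its
    average form is summed by induction on [k]. *)
Lemma sgd_sum (R : realType) (d N : nat) (f : 'I_N -> 'cV[R]_d -> R) (L : R)
    (eta : nat -> R) (b : nat -> nat) (x0 : 'cV[R]_d) :
  (0 < N)%N -> 0 < L -> (forall i, Lsmooth L (f i)) ->
  (sigmastar2 f < +oo)%E ->
  (forall k, 0 < eta k) -> (forall k, eta k * L <= 1) ->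
  (forall k, (0 < b k)%N) -> forall k,
  \sum_(i < k) eta i *
      mean (fun h : hist N b i =>
              enorm (grad (favg f) (hist_sgd f eta x0 h)) ^+ 2)
    <= 2 * (favg f x0 - mean (fun h : hist N b k =>
                                favg f (hist_sgd f eta x0 h)))
       + \sum_(i < k) L * eta i ^+ 2 * (d%:R * fine (sigmastar2 f) / (b i)%:R).
Proof.
move=> N0 L0 fL fin eta0 etaL b0; elim=> [|k IHk].
  by rewrite !big_ord0 /= mean_cst ?card_unit//= subrr mulr0 addr0.
rewrite !big_ord_recr/= mean_pair/=.
set M := mean (fun h => enorm _ ^+ 2); set V := d%:R * _ / _.
set F1 := mean (fun h => mean _).
set F0 := mean (fun h => favg _ _) in IHk.
have step : F1 <= F0 - eta k / 2 * M + L * eta k ^+ 2 / 2 * V.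
  rewrite -mulNr -[X in _ <= _ + X](@mean_cst _ (hist N b k)) ?card_hist_gt0//.
  rewrite -meanZ -!meanD; apply: ler_mean => h; rewrite mulNr.
  exact: sgd_step.
lra.
Qed.

(** * The law of the history *)

(** The family of indices over which the independence hypothesis is used. *)
Definition draws (b : nat -> nat) (k : nat) : seq {i : nat & 'I_(b i)} :=
  [seq Tagged (fun i => 'I_(b i)) j | i <- iota 0 k, j <- enum 'I_(b i)].

Lemma mem_draws (b : nat -> nat) (k : nat) (p : {i : nat & 'I_(b i)}) :
  (p \in draws b k) = (tag p < k)%N.
Proof.
case: p => i j /=.
apply/allpairsPdep/idP => [[i' [j' [+ _ /(congr1 tag)/=]]]|ik].
  by rewrite mem_iota add0n => /= i'k ->.
by exists i, j; rewrite mem_iota mem_enum.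
Qed.

Lemma uniq_draws (b : nat -> nat) (k : nat) : uniq (draws b k).
Proof.
apply: allpairs_uniq_dep; first exact: iota_uniq.
  by move=> i _; exact: enum_uniq.
by move=> [i j] [i' j'] _ _.
Qed.

Lemma hist_of_eq (N : nat) (b : nat -> nat)
    (a a' : forall k, 'I_(b k) -> 'I_N) (k : nat) :
  hist_of a k = hist_of a' k <->
  (forall p, p \in draws b k -> a (tag p) (tagged p) = a' (tag p) (tagged p)).
Proof.
split=> [|eqa].
  elim: k => [|k IHk]/= => [_ p|[/IHk eqa /ffunP eqk] p]; rewrite mem_draws//.
  rewrite ltnS leq_eqVlt => /orP[|pk]; last by rewrite eqa// mem_draws.
  by case: p => i j /= /eqP ik; subst i; have := eqk j; rewrite !ffunE.
elim: k eqa => [//|k IHk]/= eqa; congr (_, _).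
  by apply: IHk => p; rewrite mem_draws => pk; rewrite eqa// mem_draws ltnW.
apply/ffunP => j; rewrite !ffunE.
by have := eqa (Tagged (fun i => 'I_(b i)) j); rewrite mem_draws/= => ->.
Qed.

(** Lets an event about the history be read as an event about the family of
    draws. *)
Lemma hist_of_surj (N : nat) (b : nat -> nat) (k : nat) (h : hist N b k) :
  (0 < N)%N -> exists a, h = hist_of a k.
Proof.
move=> N0; elim: k h => [[]|k IHk]; first by exists (fun _ _ => Ordinal N0).
move=> /= [h s]; have [a ->] := IHk h.
(* [a] with its values at the dependent index [k] replaced by [s]. *)
pose a' : forall i, 'I_(b i) -> 'I_N := dfwith a k (fun j => s j).
exists a'; congr (_, _).
  apply/hist_of_eq => p; rewrite mem_draws => pk.
  by rewrite /a' dfwithout// gt_eqF.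
by apply/ffunP => j; rewrite ffunE /a' dfwithin.
Qed.

(** The random variable takes values in an arbitrary type that carries no
    sigma-algebra, so only its fibers are required to be measurable. *)
Lemma expectation_finite_range (R : realType) (dT : measure_display)
    (T : measurableType dT) (P : probability T R) (U : choiceType)
    (X : T -> U) (r : seq U) (F : U -> R) :
  uniq r -> (forall w, X w \in r) ->
  (forall y, measurable (X @^-1` [set y])) ->
  (forall y, 0 <= F y) ->
  ('E_P[fun w => F (X w)] = \sum_(y <- r) (F y)%:E * P (X @^-1` [set y]))%E.
Proof.
move=> r_uniq Xr mX F0.
have -> : ('E_P[fun w => F (X w)] =
    \int[P]_w \sum_(y <- r) ((F y)%:E * (\1_(X @^-1` [set y]) w)%:E))%E.
  rewrite unlock; apply: eq_integral => w _.
  rewrite (bigD1_seq (X w))//= indicE mem_set// mule1 big1 ?adde0// => y yX.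
  by rewrite indicE memNset ?mule0// => Xy; rewrite -Xy eqxx in yX.
rewrite ge0_integral_sum//.
- apply: eq_bigr => y _; rewrite ge0_integralZl_EFin//.
  + by rewrite integral_indic// setIT.
  + by apply/measurable_EFinP; exact: measurable_indic.
- move=> y; apply: measurable_funeM.
  by apply/measurable_EFinP; exact: measurable_indic.
- by move=> y w _; rewrite mule_ge0// lee_fin.
Qed.

Lemma hist_event (N : nat) (b : nat -> nat) (T : Type)
    (om : forall k : nat, 'I_(b k) -> T -> 'I_N) (k : nat)
    (a : forall k, 'I_(b k) -> 'I_N) :
  (fun w => hist_of (fun i j => om i j w) k) @^-1` [set hist_of a k] =
  \bigcap_(p in [set` draws b k])
    (om (tag p) (tagged p) @^-1` [set a (tag p) (tagged p)]).
Proof.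
by apply/seteqP; split=> w /= => [/hist_of_eq|aw]; last exact/hist_of_eq.
Qed.

Lemma hist_rv (N : nat) (b : nat -> nat) (dT : measure_display)
    (T : measurableType dT) (om : forall k : nat, 'I_(b k) -> T -> 'I_N)
    (k : nat) : (0 < N)%N ->
  (forall k (j : 'I_(b k)), finite_rv (om k j)) ->
  finite_rv (fun w => hist_of (fun i j => om i j w) k).
Proof.
move=> N0 om_rv A.
have -> : (fun w => hist_of (fun i j => om i j w) k) @^-1` A =
    \bigcup_(h in A) ((fun w => hist_of (fun i j => om i j w) k) @^-1` [set h]).
  apply/seteqP; split=> [w Aw|w [h Ah /= ->]//].
  by exists (hist_of (fun i j => om i j w) k).
apply: fin_bigcup_measurable => [|h _]; first exact: finite_finset.
have [a ->] := hist_of_surj h N0; rewrite hist_event.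
apply: fin_bigcap_measurable => // p _; exact: om_rv.
Qed.

(** The event is an intersection, over the [draws b k], of independent events of
    probability [N^-1]; there are [N] to the number of draws histories. *)
Lemma hist_law (R : realType) (N : nat) (b : nat -> nat) (dT : measure_display)
    (T : measurableType dT) (P : probability T R)
    (om : forall k : nat, 'I_(b k) -> T -> 'I_N) : (0 < N)%N ->
  (forall k (j : 'I_(b k)) (i : 'I_N),
     P (om k j @^-1` [set i]) = (N%:R^-1)%:E) ->
  mutually_independent P
     (fun kj : {k : nat & 'I_(b k)} => sigalg_rv (om (tag kj) (tagged kj))) ->
  forall k (h : hist N b k),
  P ((fun w => hist_of (fun i j => om i j w) k) @^-1` [set h])
    = (#|hist N b k|%:R^-1)%:E.
Proof.
move=> N0 om_unif om_indep k h.
have [a ->] := hist_of_surj h N0; rewrite hist_event.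
rewrite om_indep ?uniq_draws//; last first.
  by move=> p _; exists [set a (tag p) (tagged p)] => //; rewrite setTI.
rewrite (eq_bigr (fun=> (N%:R^-1)%:E)) => [|p _]; last exact: om_unif.
rewrite prodEFin big_allpairs_dep card_hist natr_prod -prodfV; congr _%:E.
rewrite -[iota 0 k](_ : index_iota 0 k = _) ?/index_iota ?subn0//.
by apply: eq_bigr => i _; rewrite big_enum prodr_const card_ord exprVn natrX.
Qed.

(** * Expectations along the iterates *)

Lemma borel_set1 (U : topologicalType) (y : U) :
  accessible_space U -> @borel U [set y].
Proof.
move=> accU; rewrite /borel -[[set y]]setCK -setTD.
apply: sigma_algebraCD; apply: sub_sigma_algebra.
by rewrite openC; exact: accessible_closed_set1.
Qed.

(** The pair [Y] of the index and the selected value has finite range, and its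
    fiber at [(j, y)] is the intersection of [K = j] and [X j = y].  The second
    event belongs to the sigma-algebra of the process because points are
    closed. *)
Lemma expectation_random_index (R : realType) (dT : measure_display)
    (T : measurableType dT) (P : probability T R) (U : topologicalType)
    (n : nat) (K : T -> 'I_n) (X : nat -> T -> U) (r : 'I_n -> seq U)
    (p : 'I_n -> R) (F : U -> R) :
  accessible_space U ->
  finite_rv K -> (forall j, P (K @^-1` [set j]) = (p j)%:E) ->
  independent2 P (sigalg_rv K) (sigalg_process X) ->
  (forall j, uniq (r j)) -> (forall (j : 'I_n) w, X j w \in r j) ->
  (forall (j : 'I_n) y, measurable (X j @^-1` [set y])) ->
  (forall y, 0 <= F y) ->
  ('E_P[fun w => F (X (K w) w)]
    = \sum_(j < n) (p j)%:E * 'E_P[fun w => F (X j w)])%E.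
Proof.
move=> accU K_rv pK indep r_uniq Xr mX F0.
pose Y w := (K w, X (K w) w).
pose s : seq ('I_n * U) := [seq (j, y) | j <- enum 'I_n, y <- r j].
have YE j y : Y @^-1` [set (j, y)] = K @^-1` [set j] `&` X j @^-1` [set y].
  by apply/seteqP; split=> w /=; rewrite /Y => -[<- <-].
have PY j y : P (Y @^-1` [set (j, y)]) = ((p j)%:E * P (X j @^-1` [set y]))%E.
  rewrite YE -pK; apply: indep; first by exists [set j]; rewrite ?setTI.
  apply: sub_sigma_algebra; exists (j : nat) => //.
  by exists [set y]; rewrite ?setTI//; exact: borel_set1.
rewrite (@expectation_finite_range _ _ _ P _ Y s (fun z => F z.2)).
- rewrite big_allpairs_dep big_enum; apply: eq_bigr => j _.
  rewrite (@expectation_finite_range _ _ _ P _ (X j) (r j) F)//.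
  rewrite ge0_sume_distrr => [|y _]; last by rewrite mule_ge0// lee_fin.
  by apply: eq_bigr => y _; rewrite PY muleCA.
- apply: allpairs_uniq_dep; [exact: enum_uniq|by []|].
  by move=> [j y] [j' y'] _ _ /= [-> ->].
- by move=> w; apply/allpairsPdep; exists (K w), (X (K w) w); rewrite mem_enum.
- move=> [j y]; rewrite YE; apply: measurableI => //; exact: K_rv.
- by move=> z; exact: F0.
Qed.

Lemma expectation_sgd (R : realType) (d N : nat) (f : 'I_N -> 'cV[R]_d -> R)
    (eta : nat -> R) (b : nat -> nat) (x0 : 'cV[R]_d) (dT : measure_display)
    (T : measurableType dT) (P : probability T R)
    (om : forall k : nat, 'I_(b k) -> T -> 'I_N) (F : 'cV[R]_d -> R) :
  (0 < N)%N ->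
  (forall k (j : 'I_(b k)), finite_rv (om k j)) ->
  (forall k (j : 'I_(b k)) (i : 'I_N),
     P (om k j @^-1` [set i]) = (N%:R^-1)%:E) ->
  mutually_independent P
     (fun kj : {k : nat & 'I_(b k)} => sigalg_rv (om (tag kj) (tagged kj))) ->
  (forall x, 0 <= F x) -> forall k,
  'E_P[fun w => F (sgd f om eta x0 k w)]%E
    = (mean (fun h : hist N b k => F (hist_sgd f eta x0 h)))%:E.
Proof.
move=> N0 om_rv om_unif om_indep F0 k.
pose H w := hist_of (fun i j => om i j w) k.
under eq_fun do rewrite sgd_hist.
rewrite (@expectation_finite_range _ _ _ P _ H (index_enum (hist N b k))
           (fun h => F (hist_sgd f eta x0 h))).
- rewrite /mean mulr_sumr -sumEFin; apply: eq_bigr => h _.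
  by rewrite hist_law// EFinM muleC.
- exact: index_enum_uniq.
- by move=> w; rewrite mem_index_enum.
- by move=> h; exact: hist_rv.
- by [].
Qed.

(** * The bound at the random index *)

Theorem theoremE1 (R : realType) (d N : nat)
  (f : 'I_N -> 'cV[R]_d -> R) (xstar : 'cV[R]_d) (L : R)
  (eta : nat -> R) (b : nat -> nat) (x0 : 'cV[R]_d)
  (dT : measure_display) (T : measurableType dT) (P : probability T R)
  (om : forall k : nat, 'I_(b k) -> T -> 'I_N)
  (f_C1 : forall i, C1 (f i))
  (xstar_min : forall x, favg f xstar <= favg f x)
  (L_gt0 : 0 < L)
  (f_smooth : forall i, Lsmooth L (f i))
  (sigma_fin : (sigmastar2 f < +oo)%E)
  (eta_gt0 : forall k, 0 < eta k)
  (eta_noninc : nonincreasing_seq eta)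
  (b_ge1 : forall k, (1 <= b k)%N)
  (om_rv : forall k (j : 'I_(b k)), finite_rv (om k j))
  (om_unif : forall k (j : 'I_(b k)) (i : 'I_N),
     P (om k j @^-1` [set i]) = (N%:R^-1)%:E)
  (om_indep : mutually_independent P
     (fun kj : {k : nat & 'I_(b k)} => sigalg_rv (om (tag kj) (tagged kj))))
  (k : nat) (ktilde : T -> 'I_k.+1)
  (ktilde_rv : finite_rv ktilde)
  (ktilde_law : forall j : 'I_k.+1,
     P (ktilde @^-1` [set j]) = (psi eta j / phi eta k.+1)%:E)
  (ktilde_indep : independent2 P (sigalg_rv ktilde)
     (sigalg_process (sgd f om eta x0))) :
  let h := eta 0%N in
  h <= 1 / L ->
  ('E_P[fun w => (enorm (grad (favg f) (sgd f om eta x0 (ktilde w) w)) ^+ 2)%R]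
   <= (2 * (favg f x0 - favg f xstar) / (h * phi eta k.+1) +
       h * d%:R * L * fine (sigmastar2 f) / (h * phi eta k.+1) *
       \sum_(i < k.+1) (psi eta i ^+ 2 / (b i)%:R * h))%R%:E)%E.
Proof.
move=> h hL.
(* The probability space is not empty, and a draw provides an index. *)
have N0 : (0 < N)%N.
  have /set0P[w _] : [set: T] != set0.
    apply/eqP => T0; have := @probability_setT _ _ _ P.
    by rewrite T0 measure0 => /eqP; rewrite eq_sym onee_eq0.
  exact: leq_ltn_trans (leq0n _) (ltn_ord (om 0%N (Ordinal (b_ge1 0%N)) w)).
have h0 : 0 < h by exact: eta_gt0.
have etaL i : eta i * L <= 1.
  rewrite -ler_pdivlMr//; apply: le_trans hL; exact: eta_noninc.
have etaE i : eta i = h * psi eta i by rewrite /psi mulrC divfK// gt_eqF.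
pose F (x : 'cV[R]_d) := enorm (grad (favg f) x) ^+ 2.
have F0 x : 0 <= F x by exact: sqr_ge0.
pose M i := mean (fun u : hist N b i => F (hist_sgd f eta x0 u)).
pose r (i : 'I_k.+1) : seq 'cV[R]_d :=
  undup [seq hist_sgd f eta x0 u | u <- enum (hist N b i)].
have accU : accessible_space 'cV[R]_d.
  by apply: hausdorff_accessible; exact: norm_hausdorff.
rewrite (@expectation_random_index _ _ _ P _ _ ktilde (sgd f om eta x0) r
          (fun j => psi eta j / phi eta k.+1) F)//; last 3 first.
- by move=> i; exact: undup_uniq.
- move=> i w; rewrite mem_undup sgd_hist; apply/mapP.
  by eexists; [exact: mem_enum|].
- move=> i y.
  rewrite (_ : _ @^-1` _ = (fun w => hist_of (fun i j => om i j w) i) @^-1`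
             [set u | hist_sgd f eta x0 u = y]); first exact: hist_rv.
  by apply/seteqP; split=> w /=; rewrite sgd_hist.
under eq_bigr do
  rewrite (expectation_sgd _ _ _ N0 om_rv om_unif om_indep F0) -EFinM.
rewrite sumEFin lee_fin.
have phi0 : 0 < phi eta k.+1.
  rewrite /phi big_ord_recl ltr_wpDr//; last by rewrite divr_gt0.
  by apply: sumr_ge0 => i _; rewrite divr_ge0// ltW.
have hphi0 : 0 < h * phi eta k.+1 by rewrite mulr_gt0.
rewrite [X in _ + X]mulrAC -mulrDl ler_pdivlMr//.
have -> : (\sum_(j < k.+1) psi eta j / phi eta k.+1 * M j) * (h * phi eta k.+1)
    = \sum_(j < k.+1) eta j * M j.
  rewrite mulr_suml; apply: eq_bigr => j _; rewrite etaE.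
  by field; rewrite gt_eqF.
have := sgd_sum x0 N0 L_gt0 f_smooth sigma_fin eta_gt0 etaL b_ge1 k.+1.
set m := mean _ => sum_le.
have m_min : favg f xstar <= m.
  rewrite -(@mean_cst _ (hist N b k.+1) (favg f xstar)) ?card_hist_gt0//.
  exact: ler_mean.
apply: le_trans sum_le _; apply: lerD; first by rewrite ler_pM2l// lerD2l lerN2.
rewrite mulr_sumr; apply: ler_sum => i _.
rewrite etaE le_eqVlt; apply/orP; left; apply/eqP; field.
by rewrite pnatr_eq0 -lt0n.
Qed.
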